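(* Suppose that the filtration $(\mathcal{F}_t)_{t\in[0,T]}$ on the probability space $(\Omega,\mathcal{F},P)$ satisfies the usual conditions. Then every distribution stopping time $\delta$ is equivalent to a unique (up to indistinguishability) randomized stopping time $\rho$ and to some mixed stopping time $\mu$. That is, there is a randomized stopping time $\rho$ with $\delta_\rho=\delta$, any two such randomized stopping times are indistinguishable ($P$-almost surely equal for all $t\in[0,T]$ simultaneously), and there is a mixed stopping time $\mu$ with $\delta_\mu=\delta$.
   Context: $T>0$; $I=[0,1]$ is equipped with its Borel $\sigma$-algebra $\mathcal{B}$ and Lebesgue measure $\lambda$. The filtration satisfies the usual conditions if $\mathcal{F}=\bigvee_{t\in[0,T]}\mathcal{F}_t$; $\mathcal{F}_0$ contains all $P$-null sets; and $\mathcal{F}_t=\bigcap_{s>t}\mathcal{F}_s$ (right continuity). Measurability with respect to a $\sigma$-algebra always means with respect to its completion under the underlying measure ($P$ on $\Omega$, $P\otimes\lambda$ on $\Omega\times I$). A mixed stopping time is a function $\mu:\Omega\times I\to[0,T]$ such that $\{(\omega,r)\in\Omega\times I:\mu(\omega,r)\le t\}$ is $(\mathcal{F}_t\otimes\mathcal{B})$-measurable for every $t\in[0,T]$. A randomized stopping time is an adapted $[0,1]$-valued process $\rho=(\rho_t)_{t\in[0,T]}$ with right-continuous nondecreasing paths and $\rho_T\equiv 1$. A distribution stopping time is a probability measure $\delta$ on $\Omega\times[0,T]$ (with product $\sigma$-algebra $\mathcal{F}\otimes$ Borel) such that (1) the marginal of $\delta$ on $\Omega$ is $P$; (2) for every $t\in[0,T]$,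 the Radon-Nikodym derivative with respect to $P$ of the measure $\delta^t(A):=\delta(A\times[0,t])$, $A\in\mathcal{F}$, is $\mathcal{F}_t$-measurable. A mixed stopping time $\mu$ defines the distribution stopping time $\delta_\mu$ by $\delta_\mu(A\times[0,t])=(P\otimes\lambda)(\{(\omega,r):\omega\in A,\ \mu(\omega,r)\le t\})$, and a randomized stopping time $\rho$ defines $\delta_\rho$ by $\delta_\rho(A\times[0,t])=\int_A\rho_t(\omega)\,P(d\omega)$, for all $t\in[0,T]$, $A\in\mathcal{F}$. A mixed (resp. randomized) stopping time $\eta$ is equivalent to the distribution stopping time $\delta$ if $\delta_\eta=\delta$. *)

(* Defs.v *)
From HB Require Import structures.
From mathcomp Require Import all_boot all_order all_algebra.
From mathcomp Require Import all_classical all_reals all_analysis.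
From mathcomp Require Import measurable_realfun.

Set Implicit Arguments.
Unset Strict Implicit.
Unset Printing Implicit Defensive.
Import Order.TTheory GRing.Theory Num.Theory.
Import numFieldNormedType.Exports.
Local Open Scope classical_set_scope.
Local Open Scope charge_scope.
Local Open Scope ring_scope.

(* The interval [0, T] of times and the randomization space [0, 1] are subsets
   of R: a family indexed by [0, T] is a function on R of which only the
   values on [0, T] matter, and Omega x [0, 1] is a subset of Omega x R. *)

(* Completion of the sigma-algebra G under (the restriction to G of) m. *)
Definition completion (S : Type) (R : realType) (m : set S -> \bar R)
    (G : set (set S)) : set (set S) :=
  [set E | exists A B, [/\ G A, G B, A `<=` E, E `<=` B & m (B `\` A) = 0%E]].

Section stopping_times.
Context {R : realType} {d : measure_display} {Omega : measurableType d}.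
Variables (P : probability Omega R) (T : R) (F : R -> set (set Omega)).

Local Notation RB := (measurableTypeR R).
Local Notation lambda := (@lebesgue_measure R).

Definition is_filtration : Prop :=
  [/\ forall t, 0 <= t <= T -> sigma_algebra setT (F t),
      forall t, 0 <= t <= T -> F t `<=` measurable &
      forall s t, 0 <= s -> s <= t -> t <= T -> F s `<=` F t].

(* Null sets are taken with respect to the completion of P, hence negligible.
   Right continuity is required at t < T only: at t = T there is no s > t. *)
Definition usual_conditions : Prop :=
  [/\ measurable = <<s \bigcup_(t in `[0, T]) F t >>,
      forall N, P.-negligible N -> F 0 N &
      forall t, 0 <= t < T -> F t = \bigcap_(s in `]t, T]) F s].

(* F_t-measurability, with respect to the completion of F_t under P. *)
Definition measurable_at d' (V : measurableType d') (t : R) (f : Omega -> V) :=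
  forall Y, measurable Y -> completion P (F t) (f @^-1` Y).

(* The sigma-algebra F_t (x) Borel([0, 1]) on Omega x [0, 1]. *)
Definition prod_borel01 (t : R) : set (set (Omega * RB)) :=
  <<s setT `*` `[0, 1],
      [set A `*` B | A in F t &
                     B in [set B : set RB | measurable B /\ B `<=` `[0, 1]]] >>.

Definition is_mixed_stopping_time (mu : Omega * RB -> R) : Prop :=
  (forall omega r, 0 <= r <= 1 -> 0 <= mu (omega, r) <= T) /\
  (forall t, 0 <= t <= T ->
     completion (P \x lambda)%E (prod_borel01 t)
       [set x | 0 <= x.2 <= 1 /\ mu x <= t]).

Definition is_randomized_stopping_time (rho : R -> Omega -> R) : Prop :=
  [/\ forall t omega, 0 <= t <= T -> 0 <= rho t omega <= 1,
      forall t, 0 <= t <= T -> measurable_at t (rho t : Omega -> RB),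
      forall t omega, 0 <= t < T -> rho s omega @[s --> t^'+] --> rho t omega,
      forall s t omega, 0 <= s -> s <= t -> t <= T -> rho s omega <= rho t omega &
      forall omega, rho T omega = 1].

Section distribution.
Variable delta : probability (Omega * RB)%type R.

Definition delta_upto (t : R) (A : set Omega) : \bar R :=
  delta (A `*` `[0, t]).

Section instances.
Variable t : R.

Let measurable_rect (A : set Omega) :
  measurable A -> measurable (A `*` `[0, t] : set (Omega * RB)).
Proof. by move=> mA; apply: measurableX => //; exact: measurable_itv. Qed.

Let delta_upto0 : delta_upto t set0 = 0%E.
Proof. by rewrite /delta_upto set0X measure0. Qed.

Let delta_upto_ge0 A : (0 <= delta_upto t A)%E.
Proof. exact: measure_ge0. Qed.

Let delta_upto_sigma_additive : semi_sigma_additive (delta_upto t).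
Proof.
move=> A mA tA mUA; rewrite /delta_upto setX_bigcupl.
apply: measure_semi_sigma_additive => [n||].
- exact: measurable_rect.
- apply/trivIsetP => i j _ _ ij; rewrite -setXI.
  by move/trivIsetP : tA => ->//; rewrite set0X.
- by rewrite -setX_bigcupl; exact: measurable_rect.
Qed.

HB.instance Definition _ := isMeasure.Build _ _ _ (delta_upto t)
  delta_upto0 delta_upto_ge0 delta_upto_sigma_additive.

Let delta_upto_fin : fin_num_fun (delta_upto t).
Proof. by move=> A mA; apply: fin_num_measure; exact: measurable_rect. Qed.

HB.instance Definition _ := Measure_isFinite.Build _ _ _ (delta_upto t)
  delta_upto_fin.

End instances.

(* A measure on Omega x [0, T] is a measure on Omega x R that is concentrated
   on Omega x [0, T]. *)
Definition is_distribution_stopping_time : Prop :=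
  [/\ delta (setT `*` `[0, T]) = 1%E,
      forall A, measurable A -> delta (A `*` `[0, T]) = P A &
      forall t, 0 <= t <= T ->
        measurable_at t ('d (charge_of_finite_measure (delta_upto t)) '/d P)].

(* As the rectangles A x [0, t] with 0 <= t <= T form a pi-system generating
   the sigma-algebra of Omega x [0, T], the following two predicates say that
   the measure defined by mu, resp. rho, is delta.  In the first one, the outer
   measure associated with P (x) lambda provides the value of the completion of
   P (x) lambda. *)
Definition mixed_equivalent (mu : Omega * RB -> R) : Prop :=
  forall t A, 0 <= t <= T -> measurable A ->
    delta (A `*` `[0, t]) =
    ((P \x lambda)%E^*)%mu [set x | [/\ A x.1, 0 <= x.2 <= 1 & mu x <= t]].

Definition randomized_equivalent (rho : R -> Omega -> R) : Prop :=
  forall t A, 0 <= t <= T -> measurable A ->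
    delta (A `*` `[0, t]) = (\int[P]_(omega in A) (rho t omega)%:E)%E.

End distribution.

End stopping_times.

(* Main.v *)
Require Import Defs.
From mathcomp Require Import all_boot all_order all_algebra.
From mathcomp Require Import all_classical all_reals all_analysis.
From mathcomp Require Import measurable_realfun lra.
Import Order.TTheory GRing.Theory Num.Theory.
Import numFieldNormedType.Exports.
Local Open Scope classical_set_scope.
Local Open Scope ring_scope.

(** Write [delta_upto t A] for the mass that [delta] gives to [A x [0, t]].  It
    is dominated by [P], so it has a density [density t], which is
    [F t]-measurable by hypothesis.  A randomized stopping time inducing
    [delta] is therefore exactly a version of the family [density] with
    nondecreasing right-continuous paths in [0, 1] that end at 1.

    Existence of such a version.  Densities at different times are each
    defined up to a null set, and nothing relates the null sets of uncountably
    many times.  So only the densities at rational times are kept, and [rho t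
    omega] is the infimum of their values, clipped to [0, 1], over the
    rational times in the open interval from [t] to [T], and of 1.  An infimum
    over times strictly larger than [t] is nondecreasing and right-continuous
    in [t] whatever the function is, and it is 1 at [T], where no times are
    left; no exceptional set is needed for these path properties
    ([right_reg_nd], [right_reg_cvg], [right_reg_end]).  It remains to see
    that [rho t = density t] almost surely ([ae_right_density]).  On the one
    hand, [density t <= density q] almost surely for all rational [q > t], so
    [density t <= rho t].  On the other hand, [rho t <= density q] almost
    surely gives that the integral of [rho t] over [A] is at most the mass of
    [A x [0, q]], hence, letting [q] decrease to [t], at most the mass of [A x
    [0, t]] ([integral_right_density_le]); as this holds for all [A], [rho t
    <= density t].  Since [F t] contains the null sets, [rho t] inherits its
    [F t]-measurability from [density t].

    Uniqueness.  Two solutions are densities of the same measures, so they agree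
    almost surely at all rational times simultaneously, and then everywhere by
    monotonicity and right continuity ([randomized_unique]).

    The mixed stopping time is obtained by reading [t |-> rho t omega] as a
    distribution function on [0, T] and taking its quantile function: for
    [mu (omega, r) = inf {t | r <= rho t omega}], right continuity gives
    [mu (omega, r) <= t <-> r <= rho t omega] ([quantile_le]), so that the
    section of [{mu <= t}] at [omega] is the interval from 0 to [rho t omega],
    whose length is [rho t omega] ([subgraph_measure]). *)

(** * Almost sure comparison and completeness *)

Lemma ae_le_integral_le (d : measure_display) (X : measurableType d)
    (R : realType) (m : {measure set X -> \bar R}) (f g : X -> \bar R) :
  m.-integrable setT f -> m.-integrable setT g ->
  (forall A, measurable A ->
    (\int[m]_(x in A) f x <= \int[m]_(x in A) g x)%E) ->
  \forall x \ae m, (f x <= g x)%E.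
Proof.
move=> intf intg fg.
have mf := measurable_int _ intf; have mg := measurable_int _ intg.
pose E := [set x | (g x < f x)%E].
have mE : measurable E by rewrite -[E]setTI; exact: measurable_lte.
(* On [E] the pointwise and the integral inequalities are opposite, so that the
   integrals agree on every measurable part of [E]. *)
have fgE : ae_eq m E f g.
  apply: integral_ae_eq => //.
  - exact: integrableS intf.
  - exact: measurable_funS mg.
  move=> A AE mA; apply/eqP; rewrite eq_le fg//=.
  apply: le_integral => //.
  - exact: integrableS intg.
  - exact: integrableS intf.
  - by move=> x /set_mem /AE /ltW.
apply: filterS fgE => x fgx; rewrite leNgt; apply/negP => gf.
by move: (gf); rewrite (fgx gf) ltxx.
Qed.

Lemma countable_ae_forall (d : measure_display) (X : measurableType d)
    (R : realType) (m : {measure set X -> \bar R}) (I : countType)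
    (Q : I -> X -> Prop) :
  (forall i, \forall x \ae m, Q i x) -> \forall x \ae m, forall i, Q i x.
Proof.
move=> aeQ.
have : \forall x \ae m, forall n, if unpickle n is Some i then Q i x else True.
  apply: ae_foralln => n; case: unpickle => [i|]; first exact: aeQ.
  by apply: filterS filterT.
by apply: filterS => x Qx i; have := Qx (pickle i); rewrite pickleK.
Qed.

Lemma sigma_algebra_bigcup_countable (X : Type) (D : set X) (G : set (set X))
    (I : countType) (A : I -> set X) :
  sigma_algebra D G -> (forall i, G (A i)) -> G (\bigcup_i A i).
Proof.
move=> [G0 _ GU] GA.
have -> : \bigcup_i A i =
    \bigcup_n (if unpickle n is Some i then A i else set0 : set X).
  apply/seteqP; split => x [] => [i _ Ai|n _].
    by exists (pickle i); rewrite ?pickleK.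
  by case: unpickle => // i Ai; exists i.
by apply: GU => n; case: unpickle.
Qed.

Lemma integrable_itv01 (d : measure_display) (X : measurableType d)
    (R : realType) (P : probability X R) (f : X -> R) :
  measurable_fun setT f -> (forall x, 0 <= f x <= 1) ->
  P.-integrable setT (EFin \o f).
Proof.
move=> mf f01; apply: measurable_bounded_integrable => //.
  by rewrite (le_lt_trans (probability_le1 P _))// ltry.
exists 1; split => // M M1 x _ /=; have /andP[f0 f1] := f01 x.
by rewrite ger0_norm// (le_trans f1)// ltW.
Qed.

Lemma sigma_algebra_negligible (d : measure_display) (X : measurableType d)
    (R : realType) (m : {measure set X -> \bar R}) (G : set (set X))
    (E E' : set X) :
  sigma_algebra setT G -> m.-negligible `<=` G ->
  m.-negligible (E `\` E') -> m.-negligible (E' `\` E) -> G E' -> G E.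
Proof.
move=> sG nG nEE' nE'E GE'.
have gG A : G A -> @measurable _ (g_sigma_algebraType G) A.
  by move=> GA; exact: sub_sigma_algebra.
suff : @measurable _ (g_sigma_algebraType G) E by rewrite measurable_g_measurableTypeE.
have -> : E = (E' `\` (E' `\` E)) `|` (E `\` E').
  apply/seteqP; split => x /=.
    by move=> Ex; have [E'x|E'x] := pselect (E' x); [left; split=> // -[]|right].
  by move=> [[E'x /not_andP[//|/contrapT]]|[]].
by apply: measurableU; [apply: measurableD|]; apply: gG => //; exact: nG.
Qed.

Lemma completion_id (d : measure_display) (X : measurableType d)
    (R : realType) (m : {measure set X -> \bar R}) (G : set (set X)) :
  sigma_algebra setT G -> G `<=` measurable -> m.-negligible `<=` G ->
  completion m G = G.
Proof.
move=> sG Gm nG; apply/seteqP; split => E; last first.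
  by move=> GE; exists E, E; split=> //; rewrite setDv measure0.
move=> [A [B [GA GB AE EB mBA0]]].
have nBA : m.-negligible (B `\` A).
  by exists (B `\` A); split => //; apply: measurableD; exact: Gm.
apply: (@sigma_algebra_negligible _ _ _ m G E A) => //.
- by apply: negligibleS nBA; exact: setSD.
- by move: AE; rewrite -setD_eq0 => ->; exact: negligible_set0.
Qed.

(** Under the usual conditions the completions taken in the notions of stopping
    time add no sets to the filtration. *)
Lemma completion_filtration (d : measure_display) (X : measurableType d)
    (R : realType) (P : probability X R) (T : R) (F : R -> set (set X)) :
  is_filtration T F -> usual_conditions P T F ->
  forall t, 0 <= t <= T -> completion P (F t) = F t.
Proof.
move=> [sF Fm FS] [_ F0 _] t t0T; have /andP[t0 tT] := t0T.
apply: completion_id; [exact: sF|exact: Fm|].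
by move=> N /F0; apply: FS.
Qed.

(** * Right-continuous regularization of a function *)

Section right_reg.
Context {R : realType}.
Implicit Types (h : R -> R) (s t T c : R).

(** The value 1 keeps the set nonempty when [t = T], and the strict inequality
    [t < ratr q] is what makes the result right-continuous. *)
Definition right_reg T h t : R :=
  inf ([set 1] `|` [set h (ratr q) | q in [set q : rat | t < ratr q < T]]).

(** Measurability and right continuity are conditions on strict sublevel sets,
    which this lemma turns into countable unions. *)
Lemma right_reg_lt T h t c : (forall s, 0 <= h s) ->
  right_reg T h t < c <->
  1 < c \/ exists q : rat, t < ratr q < T /\ h (ratr q) < c.
Proof.
move=> h0; split.
  move=> /inf_lt[|y [->|[q tqT <-]] yc]; first by exists 1; left.
    by left.
  by right; exists q.
have lbS : has_lbound
    ([set 1] `|` [set h (ratr q) | q in [set q : rat | t < ratr q < T]]).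
  by exists 0 => _ [->|[q _ <-]].
by case=> [c1|[q [tqT hc]]]; apply: le_lt_trans; try eassumption;
  apply: ge_inf => //; [left|right; exists q].
Qed.

Lemma right_reg_ge T h t c : (forall s, 0 <= h s) ->
  c <= 1 -> (forall q : rat, t < ratr q < T -> c <= h (ratr q)) ->
  c <= right_reg T h t.
Proof.
move=> h0 c1 ch; rewrite leNgt; apply/negP => /(right_reg_lt _ _ _ _ h0)[|].
  by rewrite ltNge c1.
by move=> [q [/ch]]; rewrite leNgt => /negP.
Qed.

Lemma right_reg_le T h t (q : rat) : (forall s, 0 <= h s) ->
  t < ratr q < T -> right_reg T h t <= h (ratr q).
Proof.
move=> h0 tqT; rewrite leNgt; apply/negP => hq.
suff : right_reg T h t < right_reg T h t by rewrite ltxx.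
by apply/right_reg_lt => //; right; exists q.
Qed.

Lemma right_reg_itv T h t : (forall s, 0 <= h s) -> 0 <= right_reg T h t <= 1.
Proof.
move=> h0; rewrite right_reg_ge//= leNgt; apply/negP => r1.
suff : right_reg T h t < right_reg T h t by rewrite ltxx.
by apply/right_reg_lt => //; left.
Qed.

Lemma right_reg_end T h : (forall s, 0 <= h s) -> right_reg T h T = 1.
Proof.
move=> h0; apply/eqP; rewrite eq_le (andP (right_reg_itv T h T h0)).2/=.
apply: right_reg_ge => // q /andP[Tq qT].
by have := lt_trans Tq qT; rewrite ltxx.
Qed.

Lemma right_reg_nd T h s t : (forall s, 0 <= h s) -> s <= t ->
  right_reg T h s <= right_reg T h t.
Proof.
move=> h0 st; apply: right_reg_ge => //.
  by case/andP : (right_reg_itv T h s h0).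
by move=> q /andP[tq qT]; apply: right_reg_le; rewrite // qT (le_lt_trans st).
Qed.

(** A rational time witnessing [right_reg T h t < c] still does so at all times
    between [t] and itself. *)
Lemma right_reg_cvg T h t : (forall s, 0 <= h s) -> t < T ->
  right_reg T h s @[s --> t^'+] --> right_reg T h t.
Proof.
move=> h0 tT; apply/cvgrPdist_lt => e e0.
have : right_reg T h t < right_reg T h t + e by rewrite ltrDl.
move=> /(right_reg_lt _ _ _ _ h0) re.
have [u tu uT] : exists2 u, t < u & forall s, t < s -> s < u ->
    right_reg T h s < right_reg T h t + e.
  case: re => [r1|[q [/andP[tq qT] hq]]].
    by exists T => // s _ _; apply/right_reg_lt => //; left.
  exists (ratr q) => // s ts sq; apply/right_reg_lt => //; right.
  by exists q; rewrite sq qT.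
near=> s.
have ts : t < s by near: s; exact: nbhs_right_gt.
have su : s < u by near: s; exact: nbhs_right_lt.
have := right_reg_nd T h t s h0 (ltW ts); have := uT _ ts su.
by rewrite ltr_distl => ? ?; apply/andP; split; lra.
Unshelve. all: by end_near. Qed.

Lemma measurable_right_reg (d : measure_display) (X : measurableType d)
    T (h : R -> X -> R) t :
  (forall s x, 0 <= h s x) ->
  (forall q : rat, t < ratr q < T -> measurable_fun setT (h (ratr q))) ->
  measurable_fun setT (fun x => right_reg T (h ^~ x) t).
Proof.
move=> h0 mh; apply: (measurability _ (RGenInftyO.measurableE R)).
move=> _ [_ [c ->] <-]; rewrite setTI.
have [c1|c1] := ltP 1 c.
  rewrite (_ : _ @^-1` _ = setT); first exact: measurableT.
  apply/seteqP; split => // x _ /=; rewrite in_itv/=.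
  by apply/right_reg_lt => //; left.
rewrite (_ : _ @^-1` _ =
    \bigcup_q if t < ratr q < T then [set x | h (ratr q) x < c] else set0).
  apply: bigcupT_measurable_rat => q; case: ifPn => // /mh mhq.
  by rewrite -[X in measurable X]setTI; exact: measurable_fun_ltr.
apply/seteqP; split => x /=; rewrite in_itv/=.
  move/(right_reg_lt _ _ _ _ (h0 ^~ x)) => [|[q [tqT hq]]].
    by rewrite ltNge c1.
  by exists q => //; rewrite tqT.
move=> [q _]; case: ifP => // tqT hq.
by apply/(right_reg_lt _ _ _ _ (h0 ^~ x)); right; exists q.
Qed.

End right_reg.

(** * The densities of a distribution stopping time *)

Section density_family.
Context (R : realType) (d : measure_display) (Omega : measurableType d)
  (P : probability Omega R) (T : R) (F : R -> set (set Omega))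
  (delta : probability (Omega * measurableTypeR R)%type R).
Hypothesis delta_st : is_distribution_stopping_time P T F delta.

Let deltaT : forall A, measurable A -> delta (A `*` `[0, T]) = P A.
Proof. by case: delta_st. Qed.

Let mrect (t : R) (A : set Omega) : measurable A ->
  measurable (A `*` `[0, t] : set (Omega * measurableTypeR R)).
Proof. by move=> mA; apply: measurableX => //; exact: measurable_itv. Qed.

Lemma delta_le (A : set Omega) (s t : R) : measurable A -> s <= t ->
  (delta (A `*` `[0%R, s]) <= delta (A `*` `[0%R, t]))%E.
Proof.
move=> mA st; apply: le_measure; rewrite ?inE; [exact: mrect..|].
by move=> [w x] /= [Aw]; rewrite !in_itv/= => /andP[-> /le_trans->].
Qed.

Lemma delta_right_cvg (A : set Omega) (t u : R) : measurable A ->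
  t < u ->
  delta (A `*` `[0, t + (u - t) / n.+1%:R]) @[n --> \oo]
  --> delta (A `*` `[0, t]).
Proof.
move=> mA tu; have ut0 : 0 < u - t by rewrite subr_gt0.
have -> : A `*` `[0, t] =
    \bigcap_n (A `*` `[0, t + (u - t) / n.+1%:R]) :> set (Omega * R).
  apply/seteqP; split => [[w x] [/= Aw]|[w x] /= xn].
    rewrite in_itv/= => /andP[x0 xt] n _; split => //=.
    by rewrite in_itv/= x0 (le_trans xt)// lerDl divr_ge0// ltW.
  have [/= Aw] := xn 0%N Logic.I; rewrite in_itv/= => /andP[x0 _].
  split => //; rewrite /= in_itv/= x0/=; apply/ler_addgt0Pr => e e0.
  have [n ne] : exists n, (u - t) / n.+1%:R < e.
    exists (Num.truncn ((u - t) / e)); rewrite ltr_pdivrMr// -ltr_pdivrMl//.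
    by rewrite mulrC; exact: truncnS_gt.
  have [_ /=] := xn n Logic.I; rewrite in_itv/= => /andP[_ /le_trans]; apply.
  by rewrite lerD2l ltW.
apply: nonincreasing_cvg_mu.
- by rewrite (le_lt_trans (probability_le1 delta _))// ?ltry//; exact: mrect.
- by move=> n; exact: mrect.
- by apply: bigcapT_measurable => n; exact: mrect.
move=> n m nm; apply/subsetPset => -[w x] /= [Aw].
rewrite !in_itv/= => /andP[-> /le_trans xn]; split => //; apply: xn.
by rewrite lerD2l ler_pM2l// lef_pV2 ?posrE// ler_nat.
Qed.

Local Open Scope charge_scope.

(** The derivative is chosen finite everywhere for [t <= T], so that [fine] loses
    nothing there. *)
Definition density (t : R) (omega : Omega) : R :=
  fine (('d (charge_of_finite_measure (delta_upto delta t)) '/d P) omega).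

Lemma delta_upto_dominated (t : R) : t <= T ->
  charge_of_finite_measure (delta_upto delta t) `<< P.
Proof.
move=> tT; apply/null_content_dominatesP => A mA PA0.
apply/eqP; rewrite eq_le measure_ge0 andbT -[leRHS]PA0.
by have := delta_le _ _ _ mA tT; rewrite deltaT.
Qed.

Lemma densityE (t : R) : t <= T ->
  EFin \o density t = 'd (charge_of_finite_measure (delta_upto delta t)) '/d P.
Proof.
move=> tT; apply/funext => w /=; rewrite /density fineK//.
by apply: Radon_Nikodym_fin_num; exact: delta_upto_dominated.
Qed.

Lemma integrable_density (t : R) : t <= T ->
  P.-integrable setT (EFin \o density t).
Proof.
by move=> tT; rewrite densityE//; apply: Radon_Nikodym_integrable;
  exact: delta_upto_dominated.
Qed.

Lemma measurable_density (t : R) : t <= T -> measurable_fun setT (density t).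
Proof.
by move=> tT; apply/measurable_EFinP; apply: measurable_int (integrable_density t tT).
Qed.

Lemma integral_density (t : R) (A : set Omega) : t <= T -> measurable A ->
  delta (A `*` `[0, t]) = (\int[P]_(w in A) (density t w)%:E)%E.
Proof.
move=> tT mA; rewrite -[LHS]/(charge_of_finite_measure (delta_upto delta t) A).
rewrite (Radon_Nikodym_integral (mu := P))//; last exact: delta_upto_dominated.
by rewrite -densityE.
Qed.

Lemma ae_density_le (s t : R) : s <= t -> t <= T ->
  \forall w \ae P, density s w <= density t w.
Proof.
move=> st tT; have sT := le_trans st tT.
have : \forall w \ae P, ((density s w)%:E <= (density t w)%:E)%E.
  apply: ae_le_integral_le; [exact: integrable_density..|] => A mA.
  by rewrite -!integral_density//; exact: delta_le.
by apply: filterS => w; rewrite lee_fin.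
Qed.

Lemma ae_density_ge0 (t : R) : t <= T -> \forall w \ae P, 0 <= density t w.
Proof.
move=> tT.
have : \forall w \ae P, (0%:E <= (density t w)%:E)%E.
  apply: (ae_le_integral_le _ _ _ _ (cst 0%:E)).
  - exact: finite_measure_integrable_cst.
  - exact: integrable_density.
  move=> A mA; rewrite -integral_density//.
  by rewrite integral_cst// mul0e measure_ge0.
by apply: filterS => w; rewrite lee_fin.
Qed.

Lemma ae_density_le1 (t : R) : t <= T -> \forall w \ae P, density t w <= 1.
Proof.
move=> tT.
have : \forall w \ae P, ((density t w)%:E <= 1%:E)%E.
  apply: (ae_le_integral_le _ _ _ _ _ (cst 1%:E)).
  - exact: integrable_density.
  - exact: finite_measure_integrable_cst.
  move=> A mA; rewrite -integral_density//.
  by rewrite integral_cst// mul1e; have := delta_le _ _ _ mA tT; rewrite deltaT.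
by apply: filterS => w; rewrite lee_fin.
Qed.

(** The clipping makes the path properties of the regularization hold for every
    [omega]; almost surely it changes nothing at a given time. *)
Definition density_path (omega : Omega) (t : R) : R :=
  Num.min 1 (Num.max 0 (density t omega)).

Lemma density_path_ge0 (omega : Omega) (t : R) : 0 <= density_path omega t.
Proof. by rewrite le_min ler01 le_max lexx. Qed.

Lemma density_pathE (omega : Omega) (t : R) : 0 <= density t omega <= 1 ->
  density_path omega t = density t omega.
Proof. by case/andP=> g0 g1; rewrite /density_path max_r// min_r. Qed.

Definition right_density (t : R) (omega : Omega) : R :=
  right_reg T (density_path omega) t.

Lemma right_density_itv (t : R) (omega : Omega) :
  0 <= right_density t omega <= 1.
Proof. by apply: right_reg_itv => s; exact: density_path_ge0. Qed.

Lemma measurable_right_density (t : R) : measurable_fun setT (right_density t).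
Proof.
apply: (@measurable_right_reg R _ _ T (fun s w => density_path w s)).
  by move=> s w; exact: density_path_ge0.
move=> q /andP[_ qT]; apply: measurable_minr; first exact: measurable_cst.
apply: measurable_maxr; first exact: measurable_cst.
by apply: measurable_density; exact: ltW.
Qed.

Lemma integrable_right_density (t : R) :
  P.-integrable setT (EFin \o right_density t).
Proof.
apply: integrable_itv01; first exact: measurable_right_density.
exact: right_density_itv.
Qed.

(** The half of [right_density t = density t] that uses the continuity of [delta] from
    above along [A x [0, u]], [u] decreasing to [t]. *)
Lemma integral_right_density_le (t : R) (A : set Omega) :
  0 <= t <= T -> measurable A ->
  (\int[P]_(w in A) (right_density t w)%:E <= delta (A `*` `[0%R, t]))%E.
Proof.
move=> /andP[t0]; rewrite le_eqVlt => /predU1P[->|tT] mA.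
  (* At [T] the infimum is over [1] alone, and the mass is [P A]. *)
  rewrite deltaT// -[leRHS]mul1e -integral_cst//.
  apply: ge0_le_integral => //.
  - by move=> w _; rewrite lee_fin; case/andP: (right_density_itv T w).
  - apply/measurable_EFinP; apply: measurable_funS (measurable_right_density _) => //.
  - by move=> w _; rewrite lee_fin; case/andP: (right_density_itv T w).
apply: (cvge_ge _ (delta_right_cvg A t T mA tT)).
apply: nearW => n.
have Tt0 : 0 < T - t by rewrite subr_gt0.
have tu : t < t + (T - t) / n.+1%:R by rewrite ltrDl divr_gt0.
have uT : t + (T - t) / n.+1%:R <= T.
  by rewrite -lerBrDl ler_pdivrMr// ler_peMr ?ler1n// ltW.
have [q] := rat_in_itvoo tu; rewrite in_itv/= => /andP[tq qu].
have qT : ratr q < T by rewrite (lt_le_trans qu).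
apply: (@le_trans _ _ (delta (A `*` `[0, ratr q]))); last first.
  by apply: delta_le => //; exact: ltW.
rewrite integral_density//; last exact: ltW.
have q0 := ae_density_ge0 _ (ltW qT).
(* Clipping below by 0 keeps the integrand nonnegative everywhere and changes it
   on a null set only. *)
apply: (@le_trans _ _ (\int[P]_(w in A) (Num.max 0 (density (ratr q) w))%:E)%E).
  apply: ge0_le_integral => //.
  - by move=> w _; rewrite lee_fin; case/andP: (right_density_itv t w).
  - apply/measurable_EFinP; apply: measurable_funS (measurable_right_density _) => //.
  - apply/measurable_EFinP/measurable_maxr; first exact: measurable_cst.
    by apply: measurable_funS (measurable_density _ (ltW qT)).
  - move=> w _; rewrite lee_fin.
    apply: (@le_trans _ _ (density_path w (ratr q))).
      apply: right_reg_le; first exact: density_path_ge0.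
      by rewrite tq.
    by rewrite /density_path ge_min lexx orbT.
rewrite le_eqVlt; apply/orP; left; apply/eqP; apply: ae_eq_integral => //.
- apply/measurable_EFinP/measurable_maxr; first exact: measurable_cst.
  by apply: measurable_funS (measurable_density _ (ltW qT)).
- by apply/measurable_EFinP; apply: measurable_funS (measurable_density _ (ltW qT)).
by apply: filterS q0 => w g0 _; rewrite max_r.
Qed.

Lemma ae_right_density (t : R) : 0 <= t <= T ->
  \forall w \ae P, right_density t w = density t w.
Proof.
move=> t0T; have /andP[t0 tT] := t0T.
have le_ae : \forall w \ae P, ((right_density t w)%:E <= (density t w)%:E)%E.
  apply: ae_le_integral_le.
  - exact: integrable_right_density.
  - exact: integrable_density.
  move=> A mA; rewrite -integral_density//; exact: integral_right_density_le.
have ge_ae : \forall w \ae P, forall q : rat, t < ratr q < T ->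
    density t w <= density_path w (ratr q).
  apply: countable_ae_forall => q.
  have [/andP[tq qT]|tqT] := boolP (t < ratr q < T); last first.
    by apply: filterS filterT.
  have := ae_density_le _ _ (ltW tq) (ltW qT).
  have := ae_density_le1 _ (ltW qT); have := ae_density_ge0 _ (ltW qT).
  apply: filterS3 => w g0 g1 gtq _.
  by rewrite density_pathE// g0.
have := ae_density_le1 _ tT; move: le_ae ge_ae.
apply: filterS3 => w; rewrite lee_fin => le ge g1.
apply/eqP; rewrite eq_le le/=; apply: right_reg_ge => //.
exact: density_path_ge0.
Qed.

Lemma right_density_equivalent : randomized_equivalent P T delta right_density.
Proof.
move=> t A t0T mA; have /andP[t0 tT] := t0T; rewrite integral_density//.
apply: ae_eq_integral => //.
- by apply/measurable_EFinP; apply: measurable_funS (measurable_density _ tT).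
- by apply/measurable_EFinP; apply: measurable_funS (measurable_right_density _).
by apply: filterS (ae_right_density _ t0T) => w -> _.
Qed.

Hypothesis filtrationF : is_filtration T F.
Hypothesis usualF : usual_conditions P T F.

Lemma right_density_randomized : is_randomized_stopping_time P T F right_density.
Proof.
have [sF _ FS] := filtrationF; have [_ F0 _] := usualF.
split.
- by move=> t w _; exact: right_density_itv.
- move=> t t0T Y mY; have /andP[t0 tT] := t0T.
  have nF : P.-negligible `<=` F t by move=> N /F0; apply: FS.
  have [_ _ /(_ t t0T)] := delta_st; rewrite -densityE// => mG.
  have := mG _ (measurable_image_EFin mY).
  rewrite !(completion_filtration _ _ _ P T)//.
  have [N [mN N0 rgN]] := ae_right_density _ t0T.
  have nN : P.-negligible [set w | right_density t w <> density t w].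
    by exists N.
  apply: sigma_algebra_negligible nF _ _; first exact: sF.
    apply: negligibleS nN => w [/= Yr Yg] rg; apply: Yg.
    by exists (density t w) => //=; rewrite -rg.
  apply: negligibleS nN => w [/= [y Yy [yg]] Yr] rg; apply: Yr.
  by rewrite rg -yg.
- move=> t w /andP[t0 tT]; apply: right_reg_cvg => // s.
  exact: density_path_ge0.
- by move=> s t w s0 st tT; apply: right_reg_nd => // ?; exact: density_path_ge0.
- by move=> w; apply: right_reg_end => s; exact: density_path_ge0.
Qed.

End density_family.

(** * Uniqueness of the randomized stopping time *)

Section randomized.
Context (R : realType) (d : measure_display) (Omega : measurableType d)
  (P : probability Omega R) (T : R) (F : R -> set (set Omega)).
Hypothesis filtrationF : is_filtration T F.
Hypothesis usualF : usual_conditions P T F.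

Lemma measurable_randomized (rho : R -> Omega -> R) (t : R) :
  is_randomized_stopping_time P T F rho -> 0 <= t <= T ->
  measurable_fun setT (rho t).
Proof.
move=> [_ mrho _ _ _] t0T _ Y mY; rewrite setTI.
have := mrho t t0T _ mY; rewrite (completion_filtration _ _ _ P T)//.
by case: filtrationF => _ Fm _; exact: Fm.
Qed.

Lemma integrable_randomized (rho : R -> Omega -> R) (t : R) :
  is_randomized_stopping_time P T F rho -> 0 <= t <= T ->
  P.-integrable setT (EFin \o rho t).
Proof.
move=> rho_st t0T; apply: integrable_itv01; first exact: measurable_randomized.
by have [rho01 _ _ _ _] := rho_st => x; exact: rho01.
Qed.

(** Any later time [s] leaves room for a rational [q] between [t] and [s], and
    [rho t <= rho q = rho' q <= rho' s]; then [s] decreases to [t]. *)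
Lemma randomized_le_of_rat (rho rho' : R -> Omega -> R) (t : R) (omega : Omega) :
  is_randomized_stopping_time P T F rho ->
  is_randomized_stopping_time P T F rho' ->
  (forall q : rat, 0 <= (ratr q : R) <= T ->
    rho (ratr q) omega = rho' (ratr q) omega) ->
  0 <= t <= T -> rho t omega <= rho' t omega.
Proof.
move=> [_ _ _ rho_nd rho1] [_ _ rho'_cvg rho'_nd rho'1] eqq /andP[t0].
rewrite le_eqVlt => /predU1P[->|tT]; first by rewrite rho1 rho'1.
have t0T : 0 <= t < T by rewrite t0.
apply: (cvgr_to_ge (rho'_cvg t omega t0T)).
near=> s.
have ts : t < s by near: s; exact: nbhs_right_gt.
have sT : s < T by near: s; exact: nbhs_right_lt.
have [q] := rat_in_itvoo ts; rewrite in_itv/= => /andP[tq qs].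
have q0 := le_trans t0 (ltW tq); have qT := lt_trans qs sT.
apply: (@le_trans _ _ (rho (ratr q) omega)).
  by apply: rho_nd => //; exact: ltW.
by rewrite eqq ?q0 ?(ltW qT)//; apply: rho'_nd => //; exact: ltW.
Unshelve. all: by end_near. Qed.

Lemma randomized_unique (delta : probability (Omega * measurableTypeR R)%type R)
    (rho rho' : R -> Omega -> R) :
  is_randomized_stopping_time P T F rho ->
  randomized_equivalent P T delta rho ->
  is_randomized_stopping_time P T F rho' ->
  randomized_equivalent P T delta rho' ->
  \forall omega \ae P, forall t, 0 <= t <= T -> rho t omega = rho' t omega.
Proof.
move=> rst rE rst' rE'.
have : \forall w \ae P, forall q : rat, 0 <= (ratr q : R) <= T ->
    rho (ratr q) w = rho' (ratr q) w.
  apply: countable_ae_forall => q.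
  have [q0T|q0T] := boolP (0 <= (ratr q : R) <= T); last first.
    by apply: filterS filterT.
  have : ae_eq P setT (EFin \o rho (ratr q)) (EFin \o rho' (ratr q)).
    apply: integral_ae_eq => //.
    - exact: integrable_randomized.
    - by apply/measurable_EFinP; exact: measurable_randomized.
    by move=> A _ mA; rewrite -[LHS]rE// -[RHS]rE'.
  by apply: filterS => w /= rr _; have [] := rr Logic.I.
apply: filterS => w eqq t t0T; apply/eqP; rewrite eq_le.
rewrite !randomized_le_of_rat// => q q0T.
by rewrite eqq.
Qed.

(** * The mixed stopping time *)

Section mixed.
Variable rho : R -> Omega -> R.
Hypothesis rho_st : is_randomized_stopping_time P T F rho.
Hypothesis T_ge0 : 0 <= T.

Definition quantile (x : Omega * measurableTypeR R) : R :=
  inf [set t | 0 <= t <= T /\ x.2 <= rho t x.1].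

Lemma quantile_itv (omega : Omega) (r : R) : r <= 1 ->
  0 <= quantile (omega, r) <= T.
Proof.
have [_ _ _ _ rho1] := rho_st; move=> r1.
have ST : [set t | 0 <= t <= T /\ r <= rho t omega] T.
  by rewrite /= T_ge0 lexx rho1.
apply/andP; split.
  by apply: lb_le_inf; [exists T|move=> t /= [/andP[]]].
by apply: ge_inf => //; exists 0 => t /= [/andP[]].
Qed.

(** The infimum is attained because the paths are right-continuous. *)
Lemma quantile_le (omega : Omega) (r t : R) : 0 <= t <= T -> r <= 1 ->
  quantile (omega, r) <= t <-> r <= rho t omega.
Proof.
move=> t0T r1; have [_ _ rho_cvg rho_nd rho1] := rho_st.
split; last by move=> rt; apply: ge_inf => //; exists 0 => s /= [/andP[]].
move=> ht; have /andP[t0] := t0T.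
rewrite le_eqVlt => /predU1P[->|tT]; first by rewrite rho1.
have t0T' : 0 <= t < T by rewrite t0.
apply: (cvgr_to_ge (rho_cvg t omega t0T')).
near=> s.
have ts : t < s by near: s; exact: nbhs_right_gt.
have sT : s < T by near: s; exact: nbhs_right_lt.
have : quantile (omega, r) < s by exact: le_lt_trans ts.
move=> /inf_lt[|u /= [/andP[u0 uT] ru] us].
  by exists T; rewrite /= (le_trans t0 (ltW tT)) lexx rho1.
by apply: (le_trans ru); apply: rho_nd => //; exact: ltW.
Unshelve. all: by end_near. Qed.

Let subgraph t := [set x : Omega * measurableTypeR R |
  0 <= x.2 <= 1 /\ x.2 <= rho t x.1].

Lemma quantile_subgraph t : 0 <= t <= T ->
  [set x : Omega * measurableTypeR R | 0 <= x.2 <= 1 /\ quantile x <= t] =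
  subgraph t.
Proof.
move=> t0T; apply/seteqP; split => -[w r] [/= /andP[r0 r1]].
  by move=> /(quantile_le _ _ _ t0T r1) ?; rewrite /subgraph/= r0.
by move=> ?; rewrite r0; split => //; apply/quantile_le.
Qed.

(** In [Omega x [0, 1]], the complement [rho t omega < r] is the union over the
    rationals [q] of the rectangles [rho t omega < q <= r]. *)
Lemma prod_borel01_subgraph t : 0 <= t <= T -> prod_borel01 F t (subgraph t).
Proof.
move=> t0T.
have -> : subgraph t = (setT `*` `[0, 1]) `\`
    \bigcup_(q : rat) ([set w | rho t w < ratr q] `*` `[Num.max 0 (ratr q), 1]).
  apply/seteqP; split => -[w r].
    move=> [/= r01 rt]; split; first by rewrite /= in_itv.
    move=> [q _ [/= rq]]; rewrite in_itv/= ge_max => /andP[/andP[_ qr] _].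
    by have := le_lt_trans rt (lt_le_trans rq qr); rewrite ltxx.
  move=> [[/= _]]; rewrite in_itv/= => r01 nq; split => //=.
  rewrite leNgt; apply/negP => /rat_in_itvoo[q]; rewrite in_itv/= => /andP[rq qr].
  apply: nq; exists q => //; split => //=.
  by rewrite in_itv/= ge_max (ltW qr) andbT.
apply: sigma_algebraCD; apply: sigma_algebra_bigcup_countable => // q.
apply: sub_sigma_algebra.
exists [set w | rho t w < ratr q].
  have [_ mrho _ _ _] := rho_st.
  have := mrho t t0T _ (measurable_itv `]-oo, ratr q[).
  by rewrite (completion_filtration _ _ _ P T).
exists [set` `[Num.max 0 (ratr q), 1]] => //; split; first exact: measurable_itv.
by move=> x /=; rewrite !in_itv/= ge_max -andbA => /and3P[-> _ ->].
Qed.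

Lemma measurable_subgraph t : 0 <= t <= T -> measurable (subgraph t).
Proof.
move=> t0T; have [_ Fm _] := filtrationF.
have mD : measurable (setT `*` `[0, 1] : set (Omega * measurableTypeR R)).
  by apply: measurableX => //; exact: measurable_itv.
suff : prod_borel01 F t `<=` measurable by apply; exact: prod_borel01_subgraph.
apply: smallest_sub.
  split; [exact: measurable0|by move=> A mA; exact: measurableD|].
  by move=> A mA; exact: bigcupT_measurable.
move=> _ [A FA [B [mB _] <-]]; apply: measurableX => //; exact: Fm FA.
Qed.

Lemma subgraph_measure (A : set Omega) t : 0 <= t <= T -> measurable A ->
  ((P \x @lebesgue_measure R)%E^*)%mu
    [set x | [/\ A x.1, 0 <= x.2 <= 1 & quantile x <= t]] =
  (\int[P]_(omega in A) (rho t omega)%:E)%E.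
Proof.
move=> t0T mA; have [rho01 _ _ _ _] := rho_st.
have -> : [set x | [/\ A x.1, 0 <= x.2 <= 1 & quantile x <= t]] =
    (A `*` setT) `&` subgraph t.
  rewrite -quantile_subgraph//.
  by apply/seteqP; split => x /=; [case|case=> -[? _] []].
have mE : measurable ((A `*` setT) `&` subgraph t).
  by apply: measurableI; [exact: measurableX|exact: measurable_subgraph].
rewrite measurable_mu_extE//= /product_measure1 [RHS]integral_mkcond.
apply: eq_integral => w _ /=; rewrite patchE.
have /andP[r0 r1] := rho01 t w t0T.
have [wA|wA] := boolP (w \in A); last first.
  rewrite (_ : xsection _ _ = set0) ?measure0//.
  apply/seteqP; split => // r; rewrite /xsection/= inE => -[[/= Aw _] _].
  by move: wA; rewrite notin_setE.
rewrite (_ : xsection _ _ = [set` `[0, rho t w]]); last first.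
  apply/seteqP; split => r; rewrite /xsection/= inE in_itv/=.
    by move=> [_ [/= /andP[-> _] ->]].
  move=> /andP[rge0 rr]; split; first by split => //; exact/set_mem.
  by split => //=; rewrite rge0 (le_trans rr).
rewrite lebesgue_measure_itv/= lte_fin sube0.
by have [//|rle0] := ltP 0 (rho t w); congr EFin; apply/eqP; rewrite eq_le r0.
Qed.

Lemma quantile_mixed : is_mixed_stopping_time P T F quantile.
Proof.
split; first by move=> w r /andP[_ r1]; exact: quantile_itv.
move=> t t0T; rewrite quantile_subgraph//.
have GE := prod_borel01_subgraph _ t0T.
by exists (subgraph t), (subgraph t); split => //; rewrite setDv measure0.
Qed.

Lemma quantile_equivalent (delta : probability (Omega * measurableTypeR R)%type R) :
  randomized_equivalent P T delta rho -> mixed_equivalent P T delta quantile.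
Proof. by move=> rE t A t0T mA; rewrite rE// subgraph_measure. Qed.

End mixed.
End randomized.

Theorem corollary2 (R : realType) (d : measure_display)
    (Omega : measurableType d) (P : probability Omega R)
    (T : R) (T_gt0 : 0 < T) (F : R -> set (set Omega))
    (filtrationF : is_filtration T F) (usualF : usual_conditions P T F)
    (delta : probability (Omega * measurableTypeR R)%type R)
    (delta_st : is_distribution_stopping_time P T F delta) :
  [/\ exists rho : R -> Omega -> R,
        is_randomized_stopping_time P T F rho /\
        randomized_equivalent P T delta rho,
      forall rho rho' : R -> Omega -> R,
        is_randomized_stopping_time P T F rho ->
        randomized_equivalent P T delta rho ->
        is_randomized_stopping_time P T F rho' ->
        randomized_equivalent P T delta rho' ->
        \forall omega \ae P,
          forall t, 0 <= t <= T -> rho t omega = rho' t omega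
    & exists mu : Omega * measurableTypeR R -> R,
        is_mixed_stopping_time P T F mu /\ mixed_equivalent P T delta mu].
Proof.
have rho_st := right_density_randomized _ _ _ _ _ _ _ delta_st filtrationF usualF.
have rhoE := right_density_equivalent _ _ _ _ _ _ _ delta_st.
have T_ge0 := ltW T_gt0.
split.
- by exists (right_density R d Omega P T delta).
- by move=> rho rho'; exact: (randomized_unique _ _ _ _ _ _ filtrationF usualF).
exists (quantile R d Omega T (right_density R d Omega P T delta)); split.
  exact: (quantile_mixed _ _ _ _ _ _ filtrationF usualF).
exact: (quantile_equivalent _ _ _ _ _ _ filtrationF usualF).
Qed.
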